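(* Let $\mathcal{C}$ be a weakly Markov category. Then every morphism $f\colon X\to Y$ in $\mathcal{C}$ is equivalent to a unique discardable morphism $X\to Y$.
   Context: A gs-monoidal category is a symmetric monoidal category $(\mathcal{C},\otimes,I)$ in which every object $X$ carries a commutative comonoid structure $\mathrm{copy}_X\colon X\to X\otimes X$, $\mathrm{del}_X\colon X\to I$, multiplicative with respect to the monoidal structure: $\mathrm{copy}_{X\otimes Y}$ equals $\mathrm{copy}_X\otimes\mathrm{copy}_Y$ followed by the swap of the two middle factors, $\mathrm{del}_{X\otimes Y}=\mathrm{del}_X\otimes\mathrm{del}_Y$, and the comonoid structure on $I$ is the trivial one (coherence isomorphisms are suppressed). Naturality of $\mathrm{copy}$ and $\mathrm{del}$ is not required. For every object $X$, the set $\mathcal{C}(X,I)$ is a commutative monoid with unit $\mathrm{del}_X$ and product $ab:=(a\otimes b)\circ\mathrm{copy}_X$ (using $I\otimes I\cong I$). This monoid acts on $\mathcal{C}(X,Y)$ by $a\cdot f:=(a\otimes f)\circ\mathrm{copy}_X$ (using $I\otimes Y\cong Y$). The category $\mathcal{C}$ is called weakly Markov if for every object $X$ the monoid $\mathcal{C}(X,I)$ is a group. In a weakly Markov category, two parallel morphisms $f,g\colon X\to Y$ are called equivalent, written $f\sim g$, if there is $a\in\mathcal{C}(X,I)$ with $a\cdot f=g$. A morphism $f\colon X\to Y$ is called discardable if $\mathrm{del}_Y\circ f=\mathrm{del}_X$. *)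

(* Defs.v *)
From mathcomp Require Import ssreflect ssrfun.

Set Implicit Arguments.
Unset Strict Implicit.
Unset Printing Implicit Defensive.

Declare Scope cat_scope.
Delimit Scope cat_scope with cat.
Local Open Scope cat_scope.

Record category := Category {
  obj :> Type;
  hom : obj -> obj -> Type;
  idm : forall X : obj, hom X X;
  comp : forall X Y Z : obj, hom Y Z -> hom X Y -> hom X Z;
  comp_idl : forall (X Y : obj) (f : hom X Y), comp (idm Y) f = f;
  comp_idr : forall (X Y : obj) (f : hom X Y), comp f (idm X) = f;
  compA : forall (W X Y Z : obj) (h : hom Y Z) (g : hom X Y) (f : hom W X),
    comp h (comp g f) = comp (comp h g) f }.

Arguments idm {c} X.

Notation "g ∘ f" := (comp g f)
  (at level 40, left associativity) : cat_scope.

(* Not assumed strict: the coherence isomorphisms are kept explicit.  [alpha],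
   [lambda], [rho] and [sigma] are the associator, the two unitors and the
   braiding. *)
Record symMonoidalCategory := SymMonoidalCategory {
  smc_category :> category;
  unit_obj : smc_category;
  tens_obj : smc_category -> smc_category -> smc_category;
  tens : forall X X' Y Y' : smc_category,
    hom X X' -> hom Y Y' -> hom (tens_obj X Y) (tens_obj X' Y');
  tens_id : forall X Y : smc_category,
    tens (idm X) (idm Y) = idm (tens_obj X Y);
  tens_comp : forall (X X' X'' Y Y' Y'' : smc_category)
      (f' : hom X' X'') (f : hom X X') (g' : hom Y' Y'') (g : hom Y Y'),
    tens (f' ∘ f) (g' ∘ g) = tens f' g' ∘ tens f g;

  alpha : forall X Y Z : smc_category,
    hom (tens_obj (tens_obj X Y) Z) (tens_obj X (tens_obj Y Z));
  alpha_inv : forall X Y Z : smc_category,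
    hom (tens_obj X (tens_obj Y Z)) (tens_obj (tens_obj X Y) Z);
  alphaK : forall X Y Z : smc_category,
    alpha_inv X Y Z ∘ alpha X Y Z = idm _;
  alpha_invK : forall X Y Z : smc_category,
    alpha X Y Z ∘ alpha_inv X Y Z = idm _;
  alpha_nat : forall (X X' Y Y' Z Z' : smc_category)
      (f : hom X X') (g : hom Y Y') (h : hom Z Z'),
    alpha X' Y' Z' ∘ tens (tens f g) h = tens f (tens g h) ∘ alpha X Y Z;

  lambda : forall X : smc_category, hom (tens_obj unit_obj X) X;
  lambda_inv : forall X : smc_category, hom X (tens_obj unit_obj X);
  lambdaK : forall X : smc_category, lambda_inv X ∘ lambda X = idm _;
  lambda_invK : forall X : smc_category, lambda X ∘ lambda_inv X = idm _;
  lambda_nat : forall (X Y : smc_category) (f : hom X Y),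
    lambda Y ∘ tens (idm unit_obj) f = f ∘ lambda X;

  rho : forall X : smc_category, hom (tens_obj X unit_obj) X;
  rho_inv : forall X : smc_category, hom X (tens_obj X unit_obj);
  rhoK : forall X : smc_category, rho_inv X ∘ rho X = idm _;
  rho_invK : forall X : smc_category, rho X ∘ rho_inv X = idm _;
  rho_nat : forall (X Y : smc_category) (f : hom X Y),
    rho Y ∘ tens f (idm unit_obj) = f ∘ rho X;

  sigma : forall X Y : smc_category, hom (tens_obj X Y) (tens_obj Y X);
  sigmaK : forall X Y : smc_category, sigma Y X ∘ sigma X Y = idm _;
  sigma_nat : forall (X X' Y Y' : smc_category)
      (f : hom X X') (g : hom Y Y'),
    sigma X' Y' ∘ tens f g = tens g f ∘ sigma X Y;

  pentagon : forall W X Y Z : smc_category,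
    alpha W X (tens_obj Y Z) ∘ alpha (tens_obj W X) Y Z =
    tens (idm W) (alpha X Y Z) ∘ alpha W (tens_obj X Y) Z
      ∘ tens (alpha W X Y) (idm Z);
  triangle : forall X Y : smc_category,
    tens (idm X) (lambda Y) ∘ alpha X unit_obj Y = tens (rho X) (idm Y);
  hexagon : forall X Y Z : smc_category,
    alpha Y Z X ∘ sigma X (tens_obj Y Z) ∘ alpha X Y Z =
    tens (idm Y) (sigma X Z) ∘ alpha Y X Z ∘ tens (sigma X Y) (idm Z) }.

Arguments unit_obj {s}.

Notation "'𝟙'" := (@unit_obj _) : cat_scope.
Notation "X ⊠ Y" := (tens_obj X Y)
  (at level 35, right associativity) : cat_scope.
Notation "f ⊗ g" := (tens f g)
  (at level 35, right associativity) : cat_scope.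

Definition mid_swap (C : symMonoidalCategory) (X Y : C) :
    hom ((X ⊠ X) ⊠ (Y ⊠ Y)) ((X ⊠ Y) ⊠ (X ⊠ Y)) :=
  alpha_inv X Y (X ⊠ Y)
    ∘ (idm X ⊗ alpha Y X Y)
    ∘ (idm X ⊗ (sigma X Y ⊗ idm Y))
    ∘ (idm X ⊗ alpha_inv X Y Y)
    ∘ alpha X X (Y ⊠ Y).

(* Neither [copy] nor [del] is required to be natural. *)
Record gsMonoidalCategory := GsMonoidalCategory {
  gs_smc :> symMonoidalCategory;
  copy : forall X : gs_smc, hom X (X ⊠ X);
  del : forall X : gs_smc, hom X 𝟙;
  copyA : forall X : gs_smc,
    alpha X X X ∘ (copy X ⊗ idm X) ∘ copy X = (idm X ⊗ copy X) ∘ copy X;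
  copy_dell : forall X : gs_smc,
    lambda X ∘ (del X ⊗ idm X) ∘ copy X = idm X;
  copy_delr : forall X : gs_smc,
    rho X ∘ (idm X ⊗ del X) ∘ copy X = idm X;
  copyC : forall X : gs_smc, sigma X X ∘ copy X = copy X;
  copy_tens : forall X Y : gs_smc,
    copy (X ⊠ Y) = mid_swap X Y ∘ (copy X ⊗ copy Y);
  del_tens : forall X Y : gs_smc,
    del (X ⊠ Y) = lambda 𝟙 ∘ (del X ⊗ del Y);
  copy_unit : copy 𝟙 = lambda_inv 𝟙;
  del_unit : del 𝟙 = idm 𝟙 }.

Section GsMonoidal.

Variable C : gsMonoidalCategory.
Implicit Types X Y : C.

Definition effect_mul X (a b : hom X 𝟙) : hom X 𝟙 :=
  lambda 𝟙 ∘ (a ⊗ b) ∘ copy X.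

Definition effect_act X Y (a : hom X 𝟙) (f : hom X Y) : hom X Y :=
  lambda Y ∘ (a ⊗ f) ∘ copy X.

(* The monoid C(X, I) is a group; its monoid laws are [effect_mulA],
   [effect_mulC], [effect_mul1] and [effect_1mul] below. *)
Definition weakly_markov : Prop :=
  forall (X : C) (a : hom X 𝟙),
    exists b : hom X 𝟙, effect_mul b a = del X /\ effect_mul a b = del X.

Definition equivalent X Y (f g : hom X Y) : Prop :=
  exists a : hom X 𝟙, effect_act a f = g.

Definition discardable X Y (f : hom X Y) : Prop := del Y ∘ f = del X.

Lemma rho_unit : rho (𝟙 : C) = lambda 𝟙.
Proof.
have := copy_delr (𝟙 : C).
rewrite del_unit copy_unit tens_id comp_idr => h.
by rewrite -[RHS]comp_idl -h -compA lambdaK comp_idr.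
Qed.

Lemma sigma_unit : sigma (𝟙 : C) 𝟙 = idm (𝟙 ⊠ 𝟙).
Proof.
have := copyC (𝟙 : C); rewrite copy_unit => h.
by rewrite -[LHS]comp_idr -[in LHS]lambdaK compA h lambdaK.
Qed.

Lemma effect_actM X Y (a b : hom X 𝟙) (f : hom X Y) :
  effect_act a (effect_act b f) = effect_act (effect_mul a b) f.
Proof.
rewrite /effect_act /effect_mul.
have -> : a ⊗ (lambda Y ∘ (b ⊗ f) ∘ copy X) =
    (idm 𝟙 ⊗ lambda Y) ∘ (a ⊗ (b ⊗ f)) ∘ (idm X ⊗ copy X).
  by rewrite -!tens_comp comp_idl comp_idr.
have -> : (lambda 𝟙 ∘ (a ⊗ b) ∘ copy X) ⊗ f =
    (lambda 𝟙 ⊗ idm Y) ∘ ((a ⊗ b) ⊗ f) ∘ (copy X ⊗ idm X).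
  by rewrite -!tens_comp comp_idl comp_idr.
rewrite -rho_unit -triangle -!compA -copyA; congr (_ ∘ (_ ∘ _)).
by rewrite !compA alpha_nat.
Qed.

Lemma effect_mulA X : associative (@effect_mul X).
Proof. by move=> a b c; apply: effect_actM. Qed.

Lemma effect_mulC X : commutative (@effect_mul X).
Proof.
move=> a b; rewrite /effect_mul -{1}(copyC X) -!compA; congr (_ ∘ _).
by rewrite compA -sigma_nat sigma_unit comp_idl.
Qed.

Lemma effect_act1 X Y (f : hom X Y) : effect_act (del X) f = f.
Proof.
rewrite /effect_act.
have -> : del X ⊗ f = (idm 𝟙 ⊗ f) ∘ (del X ⊗ idm X).
  by rewrite -tens_comp comp_idl comp_idr.
by rewrite compA lambda_nat -!compA [lambda X ∘ _]compA copy_dell comp_idr.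
Qed.

Lemma effect_1mul X : left_id (del X) (@effect_mul X).
Proof. by move=> a; apply: effect_act1. Qed.

Lemma effect_mul1 X : right_id (del X) (@effect_mul X).
Proof. by move=> a; rewrite effect_mulC effect_1mul. Qed.

End GsMonoidal.

(* Main.v *)
Require Import Defs.
From mathcomp Require Import ssreflect.

(** Postcomposition with [del Y] turns the action of effects on [hom X Y] into
    multiplication in the monoid [hom X 𝟙] ([del_effect_act]).  Hence
    [effect_act a f] is discardable exactly when [a] is a left inverse of the
    effect [del Y ∘ f].  In a weakly Markov category this effect has an inverse,
    which gives existence, and inverses in a monoid are unique, which gives
    uniqueness. *)

Local Open Scope cat_scope.

(** Naturality of [lambda] at [del Y] moves the discarding of the output of
    [effect_act a f] past the unitor, onto [f] alone; naturality of [del]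
    is not involved. *)
Lemma del_effect_act (C : gsMonoidalCategory) (X Y : C) (a : hom X 𝟙)
    (f : hom X Y) :
  del Y ∘ effect_act a f = effect_mul a (del Y ∘ f).
Proof.
rewrite /effect_act /effect_mul !compA -lambda_nat.
by rewrite -(compA (lambda 𝟙)) -tens_comp comp_idl.
Qed.

Theorem proposition3p4 (C : gsMonoidalCategory) (hC : weakly_markov C)
    (X Y : C) (f : hom X Y) :
  exists! g : hom X Y, equivalent f g /\ discardable g.
Proof.
have [b [b_left b_right]] := hC X (del Y ∘ f).
exists (effect_act b f); split.
  by split; [exists b | rewrite /discardable del_effect_act].
move=> g [[a <-]]; rewrite /discardable del_effect_act => a_left.
(* A left inverse of [del Y ∘ f] equals its right inverse [b]. *)
by rewrite -(effect_mul1 a) -b_right effect_mulA a_left effect_1mul.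
Qed.
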